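(* Let $(\mathcal T,[1],\Delta)$ be a triangulated category, $\xi$ a proper class of triangles, and $X$ and $Y$ objects of $\mathcal T$. Then $\mathrm{Ext}_\xi(X,Y)=0$ if and only if the following holds: for any two triangles $A\xrightarrow{i}B\xrightarrow{d}X\xrightarrow{u}A[1]$ and $Y\xrightarrow{c}C\xrightarrow{p}D\xrightarrow{v}Y[1]$ in $\xi$ and any morphisms $\alpha:A\to C$ and $\beta:B\to D$ with $\beta i=p\alpha$, there is a lifting $\lambda:B\to C$ such that $\alpha=\lambda i$ and $\beta=p\lambda$.
   Context: $(\mathcal T,[1],\Delta)$ denotes a triangulated category with suspension autoequivalence $[1]$ (quasi-inverse $[-1]$) and class $\Delta$ of (distinguished) triangles. A triangle $X\xrightarrow{u}Y\xrightarrow{v}Z\xrightarrow{w}X[1]$ is splitting if $w=0$. A class $\xi\subseteq\Delta$ is a proper class of triangles if: (i) it contains all splitting triangles; (ii) it is closed under isomorphisms of triangles, finite coproducts and suspensions (if $X\xrightarrow{u}Y\xrightarrow{v}Z\xrightarrow{w}X[1]$ is in $\xi$ then so is $X[i]\xrightarrow{(-1)^iu[i]}Y[i]\xrightarrow{(-1)^iv[i]}Z[i]\xrightarrow{(-1)^iw[i]}X[i+1]$ for all $i\in\mathbb Z$); (iii) it is closed under base changes (if $X\to Y\to Z\xrightarrow{w}X[1]$ is in $\xi$ and $\alpha:Z'\to Z$ is any morphism, then the triangle $X\to Y'\to Z'\xrightarrow{w\alpha}X[1]$ is in $\xi$) and cobase changes (if moreover $\beta:X\to X'$ is any morphism, then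 the triangle $X'\to Y'\to Z\xrightarrow{\beta[1]w}X'[1]$ is in $\xi$); (iv) it is saturated: for any triangle $X\to Y\to Z\xrightarrow{w}X[1]$ and any morphism $\alpha:Z'\to Z$ embedded in a triangle $X'\to Z'\xrightarrow{\alpha}Z\to X'[1]$ in $\xi$, if the base change $X\to Y'\to Z'\xrightarrow{w\alpha}X[1]$ is in $\xi$, then $X\to Y\to Z\xrightarrow{w}X[1]$ is in $\xi$. $\mathrm{Ext}_\xi(X,Y)$ is the abelian group (under Baer sum) of equivalence classes of triangles $Y\to E\to X\to Y[1]$ in $\xi$, two such triangles being equivalent if there is a morphism of triangles between them which is the identity on $Y$ and on $X$; the zero element is the class of the splitting triangle. *)

(* Defs.v *)
From HB Require Import structures.
From mathcomp Require Import all_boot all_order all_algebra.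
From mathcomp.classical Require Import boolp.

Set Implicit Arguments.
Unset Strict Implicit.
Unset Printing Implicit Defensive.

Import GRing.Theory.
Local Open Scope ring_scope.

Record additiveCat := AdditiveCat {
  obj :> Type;
  mor : obj -> obj -> zmodType;
  idm : forall X, mor X X;
  compm : forall X Y Z, mor Y Z -> mor X Y -> mor X Z;
  compA : forall X Y Z W (h : mor Z W) (g : mor Y Z) (f : mor X Y),
    compm h (compm g f) = compm (compm h g) f;
  comp1m : forall X Y (f : mor X Y), compm (idm Y) f = f;
  compm1 : forall X Y (f : mor X Y), compm f (idm X) = f;
  compDl : forall X Y Z (g g' : mor Y Z) (f : mor X Y),
    compm (g + g') f = compm g f + compm g' f;
  compDr : forall X Y Z (g : mor Y Z) (f f' : mor X Y),
    compm g (f + f') = compm g f + compm g f';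
  zobj : obj;
  zobjP : idm zobj = 0;
  dsum : obj -> obj -> obj;
  in1 : forall X Y, mor X (dsum X Y);
  in2 : forall X Y, mor Y (dsum X Y);
  pr1 : forall X Y, mor (dsum X Y) X;
  pr2 : forall X Y, mor (dsum X Y) Y;
  pr1_in1 : forall X Y, compm (pr1 X Y) (in1 X Y) = idm X;
  pr2_in2 : forall X Y, compm (pr2 X Y) (in2 X Y) = idm Y;
  pr1_in2 : forall X Y, compm (pr1 X Y) (in2 X Y) = 0;
  pr2_in1 : forall X Y, compm (pr2 X Y) (in1 X Y) = 0;
  in_pr : forall X Y,
    compm (in1 X Y) (pr1 X Y) + compm (in2 X Y) (pr2 X Y) = idm (dsum X Y)
}.

Arguments mor {a} X Y.
Arguments idm {a} X.
Arguments compm {a X Y Z} g f.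
Arguments zobj {a}.
Arguments dsum {a} X Y.
Arguments in1 {a} X Y.
Arguments in2 {a} X Y.
Arguments pr1 {a} X Y.
Arguments pr2 {a} X Y.

Notation "g \oc f" := (compm g f) (at level 40, left associativity).

Definition is_iso (C : additiveCat) (X Y : C) (f : mor X Y) : Prop :=
  exists g : mor Y X, g \oc f = idm X /\ f \oc g = idm Y.

Definition is_coproduct (C : additiveCat) (I : Type) (F : I -> C) (P : C)
    (inj : forall i, mor (F i) P) : Prop :=
  forall (W : C) (f : forall i, mor (F i) W),
    exists! g : mor P W, forall i, g \oc inj i = f i.

Record functor (C D : additiveCat) := Functor {
  fobj :> C -> D;
  fmap : forall X Y, mor X Y -> mor (fobj X) (fobj Y);
  fmap1 : forall X, fmap (idm X) = idm (fobj X);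
  fmap_comp : forall X Y Z (g : mor Y Z) (f : mor X Y),
    fmap (g \oc f) = fmap g \oc fmap f
}.

Arguments fmap {C D} _ {X Y} _.

(* [desusp_susp] and [susp_desusp] are the natural isomorphisms
   X -> X[1][-1] and X[-1][1] -> X.  As usual they are taken to be compatible
   (a triangle identity); for an arbitrary choice of the first one, the
   desuspension of a distinguished triangle need not be distinguished. *)
Record suspCat := SuspCat {
  suspCat_additive :> additiveCat;
  susp : functor suspCat_additive suspCat_additive;
  desusp : functor suspCat_additive suspCat_additive;
  suspD : forall (X Y : suspCat_additive) (f g : mor X Y),
    fmap susp (f + g) = fmap susp f + fmap susp g;
  desusp_susp : forall X, mor X (desusp (susp X));
  desusp_susp_inv : forall X, mor (desusp (susp X)) X;
  susp_desusp : forall X, mor (susp (desusp X)) X;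
  susp_desusp_inv : forall X, mor X (susp (desusp X));
  desusp_suspK : forall X, desusp_susp_inv X \oc desusp_susp X = idm X;
  desusp_suspVK : forall X, desusp_susp X \oc desusp_susp_inv X = idm _;
  susp_desuspK : forall X, susp_desusp_inv X \oc susp_desusp X = idm _;
  susp_desuspVK : forall X, susp_desusp X \oc susp_desusp_inv X = idm X;
  desusp_susp_natural : forall X Y (f : mor X Y),
    desusp_susp Y \oc f = fmap desusp (fmap susp f) \oc desusp_susp X;
  susp_desusp_natural : forall X Y (f : mor X Y),
    susp_desusp Y \oc fmap susp (fmap desusp f) = f \oc susp_desusp X;
  susp_desusp_triangle : forall X,
    susp_desusp (susp X) \oc fmap susp (desusp_susp X) = idm (susp X)
}.

Arguments susp {s}.
Arguments desusp {s}.
Arguments desusp_susp {s} X.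
Arguments desusp_susp_inv {s} X.
Arguments susp_desusp {s} X.
Arguments susp_desusp_inv {s} X.

Notation suspm := (fmap susp).
Notation desuspm := (fmap desusp).

Record triangle (C : suspCat) := Triangle {
  tX : C;
  tY : C;
  tZ : C;
  tu : mor tX tY;
  tv : mor tY tZ;
  tw : mor tZ (susp tX)
}.

Arguments Triangle {C tX tY tZ} tu tv tw.

Record tri_hom (C : suspCat) (T T' : triangle C) := TriHom {
  mX : mor (tX T) (tX T');
  mY : mor (tY T) (tY T');
  mZ : mor (tZ T) (tZ T');
  mXY : mY \oc tu T = tu T' \oc mX;
  mYZ : mZ \oc tv T = tv T' \oc mY;
  mZX : suspm mX \oc tw T = tw T' \oc mZ
}.

Definition tri_iso (C : suspCat) (T T' : triangle C) : Prop :=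
  exists f : tri_hom T T', [/\ is_iso (mX f), is_iso (mY f) & is_iso (mZ f)].

Definition splitting (C : suspCat) (T : triangle C) : Prop := tw T = 0.

Definition susp_tri (C : suspCat) (T : triangle C) : triangle C :=
  Triangle (- suspm (tu T)) (- suspm (tv T)) (- suspm (tw T)).

(* The last map is -w[-1] followed by the identification
   X[1][-1] -> X -> X[-1][1]. *)
Definition desusp_tri (C : suspCat) (T : triangle C) : triangle C :=
  Triangle (- desuspm (tu T)) (- desuspm (tv T))
    (- (susp_desusp_inv (tX T) \oc desusp_susp_inv (tX T) \oc desuspm (tw T))).

(* Since each step changes the three signs, this is the triangle with maps
   (-1)^i u[i], (-1)^i v[i], (-1)^i w[i]. *)
Definition shift_tri (C : suspCat) (i : int) (T : triangle C) : triangle C :=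
  match i with
  | Posz n => iter n (@susp_tri C) T
  | Negz n => iter n.+1 (@desusp_tri C) T
  end.

Record triangulatedCat := TriangulatedCat {
  triangulated_susp :> suspCat;
  dist : triangle triangulated_susp -> Prop;
  dist_iso : forall T T', tri_iso T T' -> dist T -> dist T';
  dist_id : forall X : triangulated_susp,
    dist (Triangle (idm X) (0 : mor X zobj) 0);
  dist_complete : forall (X Y : triangulated_susp) (u : mor X Y),
    exists (Z : triangulated_susp) (v : mor Y Z) (w : mor Z (susp X)),
      dist (Triangle u v w);
  dist_rotate : forall (X Y Z : triangulated_susp)
      (u : mor X Y) (v : mor Y Z) (w : mor Z (susp X)),
    dist (Triangle u v w) <-> dist (Triangle v w (- suspm u));
  dist_morphism : forall T T' (f : mor (tX T) (tX T')) (g : mor (tY T) (tY T')),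
    dist T -> dist T' -> g \oc tu T = tu T' \oc f ->
    exists h : tri_hom T T', mX h = f /\ mY h = g;
  dist_octahedral : forall (X Y Z X' Y' Z' : triangulated_susp)
      (u : mor X Y) (j : mor Y Z') (k : mor Z' (susp X))
      (v : mor Y Z) (l : mor Z X') (i : mor X' (susp Y))
      (m : mor Z Y') (n : mor Y' (susp X)),
    dist (Triangle u j k) -> dist (Triangle v l i) ->
    dist (Triangle (v \oc u) m n) ->
    exists (f : mor Z' Y') (g : mor Y' X'),
      dist (Triangle f g (suspm j \oc i)) /\
      [/\ f \oc j = m \oc v, n \oc f = k,
          g \oc m = l & i \oc g = suspm u \oc n]
}.

Arguments dist {t} _.

Definition coproduct_closed (C : suspCat) (xi : triangle C -> Prop) : Prop :=
  forall (I : finType) (T : I -> triangle C) (P : triangle C)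
      (inj : forall i, tri_hom (T i) P),
    is_coproduct (fun i => mX (inj i)) ->
    is_coproduct (fun i => mY (inj i)) ->
    is_coproduct (fun i => mZ (inj i)) ->
    (forall i, xi (T i)) -> xi P.

(* A triangle is determined up to isomorphism by its third map, so "the"
   triangle with third map w \alpha is any distinguished one. *)
Definition base_change_closed (C : triangulatedCat)
    (xi : triangle C -> Prop) : Prop :=
  forall (X Y Z : C) (u : mor X Y) (v : mor Y Z) (w : mor Z (susp X)),
    xi (Triangle u v w) ->
  forall (Z' Y' : C) (a : mor Z' Z) (u' : mor X Y') (v' : mor Y' Z'),
    dist (Triangle u' v' (w \oc a)) -> xi (Triangle u' v' (w \oc a)).

Definition cobase_change_closed (C : triangulatedCat)
    (xi : triangle C -> Prop) : Prop :=
  forall (X Y Z : C) (u : mor X Y) (v : mor Y Z) (w : mor Z (susp X)),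
    xi (Triangle u v w) ->
  forall (X' Y' : C) (b : mor X X') (u' : mor X' Y') (v' : mor Y' Z),
    dist (Triangle u' v' (suspm b \oc w)) ->
    xi (Triangle u' v' (suspm b \oc w)).

Definition saturated (C : triangulatedCat) (xi : triangle C -> Prop) : Prop :=
  forall (X Y Z : C) (u : mor X Y) (v : mor Y Z) (w : mor Z (susp X)),
    dist (Triangle u v w) ->
  forall (X' Z' : C) (f : mor X' Z') (a : mor Z' Z) (g : mor Z (susp X')),
    xi (Triangle f a g) ->
  forall (Y' : C) (u' : mor X Y') (v' : mor Y' Z'),
    xi (Triangle u' v' (w \oc a)) -> xi (Triangle u v w).

Record properClass (C : triangulatedCat) := ProperClass {
  proper_class :> triangle C -> Prop;
  proper_dist : forall T, proper_class T -> dist T;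
  proper_splitting : forall T, dist T -> splitting T -> proper_class T;
  proper_iso : forall T T', tri_iso T T' -> proper_class T -> proper_class T';
  proper_coproduct : coproduct_closed proper_class;
  proper_shift : forall (i : int) T,
    proper_class T -> proper_class (shift_tri i T);
  proper_base_change : base_change_closed proper_class;
  proper_cobase_change : cobase_change_closed proper_class;
  proper_saturated : saturated proper_class
}.

Section AdditiveFacts.
Context {C : additiveCat}.
Implicit Types X Y Z : C.

Lemma comp0m X Y Z (f : mor X Y) : (0 : mor Y Z) \oc f = 0.
Proof. by apply: (addrI (0 \oc f)); rewrite -compDl !addr0. Qed.

Lemma compm0 X Y Z (g : mor Y Z) : g \oc (0 : mor X Y) = 0.
Proof. by apply: (addrI (g \oc 0)); rewrite -compDr !addr0. Qed.

Lemma compNm X Y Z (g : mor Y Z) (f : mor X Y) : (- g) \oc f = - (g \oc f).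
Proof. by apply/eqP; rewrite -addr_eq0 -compDl addNr comp0m. Qed.

Lemma compmN X Y Z (g : mor Y Z) (f : mor X Y) : g \oc (- f) = - (g \oc f).
Proof. by apply/eqP; rewrite -addr_eq0 -compDr addNr compm0. Qed.

End AdditiveFacts.

Section SuspFacts.
Context {C : suspCat}.
Implicit Types X Y Z : C.

Lemma suspm0 X Y : suspm (0 : mor X Y) = 0.
Proof. by apply: (addrI (suspm 0)); rewrite -suspD !addr0. Qed.

Lemma suspmN X Y (f : mor X Y) : suspm (- f) = - suspm f.
Proof. by apply/eqP; rewrite -addr_eq0 -suspD addNr suspm0. Qed.

Lemma susp_faithful X Y : injective (fun f : mor X Y => suspm f).
Proof.
move=> f g /= fg.
rewrite -[f]comp1m -[g]comp1m -(desusp_suspK Y) -!compA.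
by rewrite !desusp_susp_natural fg.
Qed.

Lemma susp_full X Y (h : mor (susp X) (susp Y)) :
  exists f : mor X Y, suspm f = h.
Proof.
exists (desusp_susp_inv Y \oc desuspm h \oc desusp_susp X).
have dsVE Z : suspm (desusp_susp_inv Z) = susp_desusp (susp Z).
  rewrite -[RHS]compm1 -fmap1 -(desusp_suspVK Z) fmap_comp compA.
  by rewrite susp_desusp_triangle comp1m.
by rewrite !fmap_comp dsVE susp_desusp_natural -compA susp_desusp_triangle compm1.
Qed.

End SuspFacts.

Section TriangulatedFacts.
Context {C : triangulatedCat}.
Implicit Types X Y Z : C.

Lemma dist_complete_conn X Y (w : mor X (susp Y)) :
  exists (E : C) (u : mor Y E) (v : mor E X), dist (Triangle u v w).
Proof.
have [W [a [b dw]]] := dist_complete w.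
pose e := susp_desusp_inv W; pose eV := susp_desusp W.
have [u uE] := susp_full (- (e \oc a)).
have [v vE] := susp_full (- (b \oc eV)).
exists (desusp W), u, v.
apply/dist_rotate/dist_rotate; rewrite uE vE !opprK.
apply: dist_iso dw.
have f1 : idm (susp Y) \oc w = w \oc idm X by rewrite comp1m compm1.
have f2 : e \oc a = e \oc a \oc idm (susp Y) by rewrite compm1.
have f3 : suspm (idm X) \oc b = b \oc eV \oc e.
  by rewrite fmap1 comp1m -compA susp_desuspVK compm1.
exists (@TriHom _ (Triangle w a b) (Triangle w (e \oc a) (b \oc eV))
          (idm _) (idm _) e f1 f2 f3).
split=> /=.
- by exists (idm X); rewrite comp1m.
- by exists (idm (susp Y)); rewrite comp1m.
- by exists eV; rewrite susp_desuspVK susp_desuspK.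
Qed.

Lemma dist_same_conn X Y E E' (w : mor X (susp Y))
    (u : mor Y E) (v : mor E X) (u' : mor Y E') (v' : mor E' X) :
    dist (Triangle u v w) -> dist (Triangle u' v' w) ->
  exists e : mor E E', e \oc u = u' /\ v' \oc e = v.
Proof.
move=> /dist_rotate/dist_rotate d /dist_rotate/dist_rotate d'.
pose T := Triangle w (- suspm u) (- suspm v).
pose T' := Triangle w (- suspm u') (- suspm v').
have sq : idm (susp Y) \oc w = w \oc idm X by rewrite comp1m compm1.
have [h [hX hY]] := @dist_morphism C T T' (idm X) (idm (susp Y)) d d' sq.
move: (mYZ h) (mZX h); rewrite hX hY /= fmap1 comp1m compm1.
have [e <-] := susp_full (mZ h).
rewrite compmN compNm -!fmap_comp => /oppr_inj/susp_faithful eu.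
by move=> /oppr_inj/susp_faithful ve; exists e.
Qed.

End TriangulatedFacts.

(* Triangles Y -> E -> X -> Y[1] in xi. *)
Record extension (C : triangulatedCat) (xi : properClass C) (X Y : C) :=
  Extension {
    ext_mid : C;
    ext_in : mor Y ext_mid;
    ext_out : mor ext_mid X;
    ext_conn : mor X (susp Y);
    ext_xi : xi (Triangle ext_in ext_out ext_conn)
  }.

Definition ext_tri (C : triangulatedCat) (xi : properClass C) (X Y : C)
    (t : extension xi X Y) : triangle C :=
  Triangle (ext_in t) (ext_out t) (ext_conn t).

Definition ext_equiv (C : triangulatedCat) (xi : properClass C) (X Y : C)
    (t t' : extension xi X Y) : Prop :=
  exists f : tri_hom (ext_tri t) (ext_tri t'), mX f = idm Y /\ mZ f = idm X.

Section Extensions.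
Context {C : triangulatedCat} {xi : properClass C}.
Implicit Types X Y : C.

Lemma ext_equivP X Y (t t' : extension xi X Y) :
  ext_equiv t t' <-> ext_conn t = ext_conn t'.
Proof.
split=> [[f [fX fZ]]|].
  by move: (mZX f); rewrite fX fZ /= fmap1 comp1m compm1.
case: t t' => [E u v w xiw] [E' u' v' w' xiw'] /= ww'; subst w'.
have [e [eu ve]] := dist_same_conn (proper_dist xiw) (proper_dist xiw').
have f1 : e \oc u = u' \oc idm Y by rewrite compm1.
have f2 : idm X \oc v = v' \oc e by rewrite comp1m.
have f3 : suspm (idm Y) \oc w = w \oc idm X by rewrite fmap1 comp1m compm1.
by exists (@TriHom _ (Triangle u v w) (Triangle u' v' w) _ e _ f1 f2 f3).
Qed.

Lemma ext_base_exists X X' Y (t : extension xi X Y) (a : mor X' X) :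
  exists t' : extension xi X' Y, ext_conn t' = ext_conn t \oc a.
Proof.
have [E [u [v d]]] := dist_complete_conn (ext_conn t \oc a).
by exists (Extension (proper_base_change (ext_xi t) d)).
Qed.

Lemma ext_cobase_exists X Y Y' (t : extension xi X Y) (b : mor Y Y') :
  exists t' : extension xi X Y', ext_conn t' = suspm b \oc ext_conn t.
Proof.
have [E [u [v d]]] := dist_complete_conn (suspm b \oc ext_conn t).
by exists (Extension (proper_cobase_change (ext_xi t) d)).
Qed.

Lemma ext_split_exists X Y :
  exists t : extension xi X Y, splitting (ext_tri t).
Proof.
have [E [u [v d]]] := dist_complete_conn (0 : mor X (susp Y)).
by exists (Extension (proper_splitting xi d erefl)).
Qed.

Definition ext_base X X' Y (t : extension xi X Y) (a : mor X' X) :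
  extension xi X' Y := projT1 (cid (ext_base_exists t a)).

Definition ext_cobase X Y Y' (t : extension xi X Y) (b : mor Y Y') :
  extension xi X Y' := projT1 (cid (ext_cobase_exists t b)).

Definition ext_split X Y : extension xi X Y :=
  projT1 (cid (ext_split_exists X Y)).

End Extensions.

Section DirectSum.
Context {C : triangulatedCat} {xi : properClass C}.
Implicit Types X Y Z : C.

Definition dsumm X X' Y Y' (f : mor X Y) (g : mor X' Y') :
    mor (dsum X X') (dsum Y Y') :=
  in1 Y Y' \oc f \oc pr1 X X' + in2 Y Y' \oc g \oc pr2 X X'.

Definition dsum_tri (T T' : triangle C) : triangle C :=
  Triangle (dsumm (tu T) (tu T')) (dsumm (tv T) (tv T'))
    (suspm (in1 (tX T) (tX T')) \oc tw T \oc pr1 (tZ T) (tZ T') +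
     suspm (in2 (tX T) (tX T')) \oc tw T' \oc pr2 (tZ T) (tZ T')).

Lemma copair_in1 X Y Z Z' W (f : mor X W) (g : mor Y W) (h : mor Z X)
    (k : mor Z' Y) :
  (f \oc h \oc pr1 Z Z' + g \oc k \oc pr2 Z Z') \oc in1 Z Z' = f \oc h.
Proof.
by rewrite compDl -!compA pr1_in1 pr2_in1 !compm0 addr0 compA compm1.
Qed.

Lemma copair_in2 X Y Z Z' W (f : mor X W) (g : mor Y W) (h : mor Z X)
    (k : mor Z' Y) :
  (f \oc h \oc pr1 Z Z' + g \oc k \oc pr2 Z Z') \oc in2 Z Z' = g \oc k.
Proof.
by rewrite compDl -!compA pr2_in2 pr1_in2 !compm0 add0r compA compm1.
Qed.

Definition dsum_in1 (T T' : triangle C) : tri_hom T (dsum_tri T T').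
Proof.
apply: (@TriHom _ T (dsum_tri T T') (in1 _ _) (in1 _ _) (in1 _ _)) => /=;
  by rewrite copair_in1.
Defined.

Definition dsum_in2 (T T' : triangle C) : tri_hom T' (dsum_tri T T').
Proof.
apply: (@TriHom _ T' (dsum_tri T T') (in2 _ _) (in2 _ _) (in2 _ _)) => /=;
  by rewrite copair_in2.
Defined.

Lemma dsum_coproduct (F : bool -> C)
    (inj : forall b, mor (F b) (dsum (F true) (F false))) :
  inj true = in1 _ _ -> inj false = in2 _ _ -> is_coproduct inj.
Proof.
move=> i1 i2 W f.
exists (f true \oc pr1 _ _ + f false \oc pr2 _ _); split.
  case; rewrite ?i1 ?i2 compDl -!compA.
    by rewrite pr1_in1 pr2_in1 compm0 addr0 compm1.
  by rewrite pr2_in2 pr1_in2 compm0 add0r compm1.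
move=> g gE; rewrite -!gE i1 i2 -!compA -compDr.
by rewrite in_pr compm1.
Qed.

Lemma dsum_tri_xi (T T' : triangle C) : xi T -> xi T' -> xi (dsum_tri T T').
Proof.
move=> xT xT'; pose F (b : bool) := if b then T else T'.
pose inj (b : bool) : tri_hom (F b) (dsum_tri T T') :=
  match b with true => dsum_in1 T T' | false => dsum_in2 T T' end.
apply: (@proper_coproduct _ xi bool F _ inj); last by case.
- exact: (@dsum_coproduct (fun b => tX (F b)) (fun b => mX (inj b))).
- exact: (@dsum_coproduct (fun b => tY (F b)) (fun b => mY (inj b))).
- exact: (@dsum_coproduct (fun b => tZ (F b)) (fun b => mZ (inj b))).
Qed.

Definition ext_dsum X X' Y Y' (t : extension xi X Y) (t' : extension xi X' Y') :
    extension xi (dsum X X') (dsum Y Y') :=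
  Extension (dsum_tri_xi (ext_xi t) (ext_xi t')).

Definition diag X : mor X (dsum X X) := in1 X X + in2 X X.

Definition codiag X : mor (dsum X X) X := pr1 X X + pr2 X X.

Definition baer_sum X Y (t t' : extension xi X Y) : extension xi X Y :=
  ext_cobase (ext_base (ext_dsum t t') (diag X)) (codiag Y).

Lemma baer_sum_conn X Y (t t' : extension xi X Y) :
  ext_conn (baer_sum t t') = ext_conn t + ext_conn t'.
Proof.
rewrite /baer_sum /ext_cobase; case: cid => /= s ->.
rewrite /ext_base; case: cid => /= r -> /=.
rewrite /diag compDr copair_in1 copair_in2 compDr !compA -!fmap_comp.
rewrite /codiag !compDl pr1_in1 pr2_in1 pr1_in2 pr2_in2 addr0 add0r.
by rewrite fmap1 !comp1m.
Qed.

Lemma ext_split_conn X Y : ext_conn (ext_split X Y : extension xi X Y) = 0.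
Proof. by rewrite /ext_split; case: cid. Qed.

Lemma ext_opp_conn X Y (t : extension xi X Y) :
  ext_conn (ext_cobase t (- idm Y)) = - ext_conn t.
Proof.
rewrite /ext_cobase; case: cid => /= s ->.
by rewrite suspmN compNm fmap1 comp1m.
Qed.

End DirectSum.

Section Ext.
Context {C : triangulatedCat} (xi : properClass C) (X Y : C).

HB.instance Definition _ := gen_eqMixin (extension xi X Y).
HB.instance Definition _ := gen_choiceMixin (extension xi X Y).

Definition ext_rel : rel (extension xi X Y) := fun t t' => `[< ext_equiv t t' >].

Lemma ext_relE t t' : ext_rel t t' = (ext_conn t == ext_conn t').
Proof. by apply/asboolP/eqP => /ext_equivP. Qed.

Lemma ext_rel_refl : reflexive ext_rel.
Proof. by move=> t; rewrite ext_relE. Qed.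

Lemma ext_rel_sym : symmetric ext_rel.
Proof. by move=> t t'; rewrite !ext_relE eq_sym. Qed.

Lemma ext_rel_trans : transitive ext_rel.
Proof. by move=> t t' t''; rewrite !ext_relE => /eqP-> /eqP->. Qed.

Canonical ext_rel_equiv : equiv_rel (extension xi X Y) :=
  EquivRel ext_rel ext_rel_refl ext_rel_sym ext_rel_trans.

Definition Ext := {eq_quot ext_rel}%qT.

HB.instance Definition _ := Choice.on Ext.

Definition Ext_class (t : extension xi X Y) : Ext := (\pi_Ext t)%qT.

Definition Ext_zero : Ext := Ext_class (ext_split X Y).
Definition Ext_add (e e' : Ext) : Ext := Ext_class (baer_sum (repr e) (repr e')).
Definition Ext_opp (e : Ext) : Ext := Ext_class (ext_cobase (repr e) (- idm Y)).

Let conn (e : Ext) : mor X (susp Y) := ext_conn (repr e).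

Let conn_class t : conn (Ext_class t) = ext_conn t.
Proof. by apply/eqP; rewrite -ext_relE; apply/eqmodP; rewrite /= reprK. Qed.

Let conn_inj : injective conn.
Proof.
by move=> e e' /eqP; rewrite -ext_relE => /eqmodP; rewrite !reprK.
Qed.

Let conn0 : conn Ext_zero = 0.
Proof. by rewrite conn_class ext_split_conn. Qed.

Let connD e e' : conn (Ext_add e e') = conn e + conn e'.
Proof. by rewrite conn_class baer_sum_conn. Qed.

Let connN e : conn (Ext_opp e) = - conn e.
Proof. by rewrite conn_class ext_opp_conn. Qed.

Lemma Ext_addA : associative Ext_add.
Proof. by move=> e f g; apply: conn_inj; rewrite !connD addrA. Qed.

Lemma Ext_addC : commutative Ext_add.
Proof. by move=> e f; apply: conn_inj; rewrite !connD addrC. Qed.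

Lemma Ext_add0 : left_id Ext_zero Ext_add.
Proof. by move=> e; apply: conn_inj; rewrite connD conn0 add0r. Qed.

Lemma Ext_addN : left_inverse Ext_zero Ext_opp Ext_add.
Proof. by move=> e; apply: conn_inj; rewrite connD connN conn0 addNr. Qed.

HB.instance Definition _ :=
  GRing.isZmodule.Build Ext Ext_addA Ext_addC Ext_add0 Ext_addN.

End Ext.

(* Main.v *)
(** The group Ext_xi(X, Y) vanishes iff every third map X -> Y[1] of a triangle
    in xi is zero.  If lifts exist and Y -> E -> X -> Y[1] is in xi with third
    map w, lifting the identity of X through E -> X, by means of the splitting
    triangle 0 -> X -> X -> 0, gives w = 0.
    Conversely, complete the square (alpha, beta) to a morphism of triangles
    with third component gamma : X -> Y[1].  As gamma d = v beta is a base
    change of v, saturation shows that gamma is a third map in xi, so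
    v beta = gamma d = 0 and beta = p lambda_1.  Then alpha - lambda_1 i = c mu
    with mu : A -> Y; the cobase change mu[1] u vanishes, so mu = nu i and
    lambda_1 + c nu is the lift. *)

Require Import Defs.
From mathcomp Require Import all_boot all_order all_algebra.

Local Open Scope ring_scope.
Import GRing.Theory.

Section Exactness.
Context {C : triangulatedCat}.
Implicit Types X Y Z W : C.

Lemma dist_third {X Y Z X' Y' Z'} {u : mor X Y} {v : mor Y Z}
    {w : mor Z (susp X)} {u' : mor X' Y'} {v' : mor Y' Z'}
    {w' : mor Z' (susp X')} {f : mor X X'} {g : mor Y Y'} :
    dist (Triangle u v w) -> dist (Triangle u' v' w') ->
    g \oc u = u' \oc f ->
  exists h : mor Z Z', h \oc v = v' \oc g /\ suspm f \oc w = w' \oc h.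
Proof.
move=> d d' sq.
have [h [<- <-]] :=
  @dist_morphism C (Triangle u v w) (Triangle u' v' w') f g d d' sq.
exists (mZ h); split; [exact (mYZ h) | exact (mZX h)].
Qed.

(** The triangle on [idm X] maps to the given one by [idm X] and [u], which factors v u through
    [zobj]. *)
Lemma dist_comp_vu {X Y Z} {u : mor X Y} {v : mor Y Z} {w : mor Z (susp X)} :
  dist (Triangle u v w) -> v \oc u = 0.
Proof.
move=> d; have [h [<- _]] := dist_third (dist_id X) d (erefl (u \oc idm X)).
exact: compm0.
Qed.

(** The map [f] extends to a map from W -> 0 -> W[1] into the rotated triangle; its third component
    is g[1] by fullness of suspension. *)
Lemma dist_weak_kernel {X Y Z W} {u : mor X Y} {v : mor Y Z}
    {w : mor Z (susp X)} {f : mor W Y} :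
  dist (Triangle u v w) -> v \oc f = 0 -> exists g : mor W X, f = u \oc g.
Proof.
move=> /dist_rotate d vf0; have /dist_rotate dW := dist_id W.
have sq : (0 : mor zobj Z) \oc (0 : mor W zobj) = v \oc f.
  by rewrite vf0 comp0m.
have [h [_]] := dist_third dW d sq; have [g <-] := susp_full h.
rewrite compmN compNm -!fmap_comp compm1 => /oppr_inj/susp_faithful fE.
by exists g.
Qed.

(** Rotated three times, the triangle starts with -u[1]; it maps to 0 -> W[1] -> W[1] by 0 and f[1],
    with third component g[1]. *)
Lemma dist_weak_cokernel {X Y Z W} {u : mor X Y} {v : mor Y Z}
    {w : mor Z (susp X)} {f : mor Y W} :
  dist (Triangle u v w) -> f \oc u = 0 -> exists g : mor Z W, f = g \oc v.
Proof.
move=> /dist_rotate/dist_rotate/dist_rotate d fu0.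
have /dist_rotate/dist_rotate dW := dist_id W.
have sq : suspm f \oc (- suspm u) = 0 \oc (0 : mor (susp X) zobj).
  by rewrite compmN -fmap_comp fu0 suspm0 oppr0 comp0m.
have [h [+ _]] := dist_third d dW sq; have [g <-] := susp_full h.
rewrite compmN compNm -!fmap_comp comp1m => /oppr_inj/susp_faithful fE.
by exists g.
Qed.

End Exactness.

Lemma Ext_eq0P (C : triangulatedCat) (xi : properClass C) (X Y : C) :
  (forall e : Ext xi X Y, e = 0) <->
  (forall (E : C) (u : mor Y E) (v : mor E X) (w : mor X (susp Y)),
     xi (Triangle u v w) -> w = 0).
Proof.
split=> [e0 E u v w xw | w0 e].
  have /eqmodP : Ext_class (Extension xw) = Ext_class (ext_split X Y).
    exact: e0.
  by rewrite /= ext_relE ext_split_conn => /eqP.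
rewrite -[e]reprK; apply/eqmodP; rewrite /= ext_relE ext_split_conn.
by apply/eqP; apply: w0 _ _ _ _ (ext_xi (repr e)).
Qed.

Theorem theorem1p3 (C : triangulatedCat) (xi : properClass C) (X Y : C) :
  (forall e : Ext xi X Y, e = 0) <->
  (forall (A B C' D : C)
      (i : mor A B) (d : mor B X) (u : mor X (susp A))
      (c : mor Y C') (p : mor C' D) (v : mor D (susp Y)),
    xi (Triangle i d u) -> xi (Triangle c p v) ->
    forall (alpha : mor A C') (beta : mor B D),
      beta \oc i = p \oc alpha ->
      exists lambda : mor B C',
        alpha = lambda \oc i /\ beta = p \oc lambda).
Proof.
split=> [/Ext_eq0P w0 | lift].
  move=> A B C' D i d u c p v xi1 xi2 alpha beta sq.
  have d1 := proper_dist xi1; have d2 := proper_dist xi2.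
  (* Rotation puts [p] first, so that [alpha] and [beta] become the first two components of a map of
     triangles. *)
  have d2r := (dist_rotate _ _ _).1 d2.
  have [gamma [gammaE _]] := dist_third d1 d2r sq.
  have gamma0 : gamma = 0.
    have [E [a [b dE]]] := dist_complete_conn gamma.
    apply: (w0 E a b).
    have [F [a' [b' dF]]] := dist_complete_conn (v \oc beta).
    have := proper_base_change xi2 dF; rewrite -gammaE.
    exact: (proper_saturated dE xi1).
  have vb0 : v \oc beta = 0 by rewrite -gammaE gamma0 comp0m.
  have [l betaE] := dist_weak_kernel d2r vb0.
  have p0 : p \oc (alpha - l \oc i) = 0.
    by rewrite compDr compmN Defs.compA -betaE sq subrr.
  have [mu muE] := dist_weak_kernel d2 p0.
  have mu0 : suspm mu \oc u = 0.
    have [E [a [b dE]]] := dist_complete_conn (suspm mu \oc u).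
    exact: w0 _ _ _ _ (proper_cobase_change xi1 dE).
  (* After two rotations [i] appears as -i[1], so mu = (-nu) i; hence the sign in the lift. *)
  have /dist_rotate/dist_rotate d1r := d1.
  have [g] := dist_weak_cokernel d1r mu0.
  have [nu <-] := susp_full g.
  rewrite compmN -compNm -suspmN -fmap_comp => /susp_faithful nuE.
  exists (l + c \oc - nu); split.
    by rewrite compDl -Defs.compA -nuE -muE addrC subrK.
  by rewrite compDr Defs.compA (dist_comp_vu d2) comp0m addr0.
apply/Ext_eq0P => E c p w xiw.
(* Here [d] stands in for the identity of X, and is itself lifted through [p]. *)
have [F [i [d dF]]] := dist_complete_conn (0 : mor X (susp zobj)).
have xiF : xi (Triangle i d 0) by apply: proper_splitting.
have sq : d \oc i = p \oc 0 by rewrite (dist_comp_vu dF) compm0.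
have [l [_ dE]] := lift _ _ _ _ _ _ _ _ _ _ xiF xiw 0 d sq.
have wp0 : w \oc p = 0.
  by apply: (dist_comp_vu ((dist_rotate _ _ _).1 (proper_dist xiw))).
have wd0 : w \oc d = 0 by rewrite dE Defs.compA wp0 comp0m.
(* In the rotated triangle [d] is followed by 0, so a map killing [d] factors through 0. *)
have [g ->] := dist_weak_cokernel ((dist_rotate _ _ _).1 dF) wd0.
exact: compm0.
Qed.
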